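(* Let $q$ be a prime power, $m$ a positive integer and $s\in\{1,\ldots,m\}$ with $\gcd(s,m)=1$. Then \[ \mathrm{stab}_{\mathrm{GL}(m,q^m)}(G_{m,s,m})=\{D_f : f\in\tilde{\mathcal{L}}_{m,q^s},\ f \text{ invertible}\}. \]
   Context: $G_{m,s,m}=\{(x,x^{q^s},\ldots,x^{q^{s(m-1)}}):x\in\mathbb{F}_{q^m}\}\subseteq\mathbb{F}_{q^m}^m$ (an $\mathbb{F}_q$-subspace). Matrices act on column vectors, and $\mathrm{stab}_{\mathrm{GL}(m,q^m)}(G_{m,s,m})$ is the set of $A\in\mathrm{GL}(m,q^m)$ with $\{Au:u\in G_{m,s,m}\}=G_{m,s,m}$. $\tilde{\mathcal{L}}_{m,q^s}$ denotes the set of $q^s$-polynomials $f(x)=a_0x+a_1x^{q^s}+\cdots+a_{m-1}x^{q^{s(m-1)}}$ with $a_i\in\mathbb{F}_{q^m}$, viewed as $\mathbb{F}_q$-linear maps $\mathbb{F}_{q^m}\to\mathbb{F}_{q^m}$; $f$ is invertible if this map is bijective. The Dickson matrix of such $f$ is the $m\times m$ matrix $D_f$ whose $(i,j)$ entry ($i,j\in\{0,\ldots,m-1\}$) is $a_{(j-i)\bmod m}^{q^{si}}$, i.e. \[ D_f=\begin{pmatrix} a_0&a_1&\cdots&a_{m-1}\\ a_{m-1}^{q^s}&a_0^{q^s}&\cdots&a_{m-2}^{q^s}\\ \vdots&&&\vdots\\ a_1^{q^{s(m-1)}}&a_2^{q^{s(m-1)}}&\cdots&a_0^{q^{s(m-1)}}\end{pmatrix}.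 \] *)

(* Defs.v *)
From HB Require Import structures.
From mathcomp Require Import all_boot all_order all_algebra.
From mathcomp Require Import classical_sets.

Set Implicit Arguments.
Unset Strict Implicit.
Unset Printing Implicit Defensive.

Import GRing.Theory.
Local Open Scope ring_scope.
Local Open Scope classical_set_scope.

Definition prime_power (q : nat) : Prop :=
  exists p e : nat, [/\ prime p, (0 < e)%N & q = (p ^ e)%N].

Section Defs.
Variable F : finFieldType.

Definition Gset (q s m : nat) : set 'cV[F]_m :=
  [set \col_(i < m) x ^+ (q ^ (s * i))%N | x in [set: F]].

Definition stabGL (m : nat) (U : set 'cV[F]_m) : set 'M[F]_m :=
  [set A | A \in unitmx /\ [set A *m u | u in U] = U].

Definition qspolys (q s m : nat) : set {poly F} :=
  [set f | exists a : 'I_m -> F,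
             f = \sum_(i < m) a i *: 'X^(q ^ (s * i))].

Definition invertible_poly (f : {poly F}) : Prop :=
  bijective (fun x : F => f.[x]).

(* The paper's coefficient a_k is the coefficient of f at 'X^(q ^ (s * k));
   see qspoly_coef. *)
Definition dickson (q s m : nat) (f : {poly F}) : 'M[F]_m :=
  \matrix_(i < m, j < m)
     f`_(q ^ (s * ((j + m - i) %% m))) ^+ (q ^ (s * i))%N.

Lemma qspoly_coef (q s m : nat) (a : 'I_m -> F) (k : 'I_m) :
  (1 < q)%N -> (0 < s)%N ->
  (\sum_(i < m) a i *: 'X^(q ^ (s * i)))`_(q ^ (s * k)) = a k.
Proof.
move=> q1 s0; rewrite coef_sum (bigD1 k) //= big1 => [|i ik].
  by rewrite coefZ coefXn eqxx mulr1 addr0.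
rewrite coefZ coefXn eqn_exp2l // eqn_pmul2l //.
by rewrite (_ : (k == i :> nat) = false) ?mulr0 //; apply/negbTE; rewrite eq_sym.
Qed.

End Defs.

Arguments Gset F q s m : clear implicits.
Arguments qspolys F q s m : clear implicits.
Arguments dickson {F} q s m f.

(* Main.v *)
Require Import Defs.
From HB Require Import structures.
From mathcomp Require Import all_boot all_order all_algebra.
From mathcomp Require Import finfield.
From mathcomp Require Import classical_sets.

Set Implicit Arguments.
Unset Strict Implicit.
Unset Printing Implicit Defensive.

Import GRing.Theory.
Local Open Scope ring_scope.
Local Open Scope classical_set_scope.

(** Write [v x] for the column [(x, x^(q^s), ..., x^(q^(s(m-1))))].  Since
    [x |-> x^(q^s)] is a field automorphism whose [m]-th iterate is the
    identity, [D_f v(x) = v(f x)] for every [q^s]-polynomial [f].  As [s] is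
    coprime to [m], the monomials [x^(q^(s j))] with [j < m] are linearly
    independent as functions (modulo [x^(q^m) - x] they have distinct degrees
    below [q^m]), so a matrix is determined by its action on the vectors [v x].
    Hence a matrix [A] stabilizing [G] is the Dickson matrix of the polynomial
    read off its first row.  Conversely, if [f] is onto, a row vector killed by
    [D_f] is orthogonal to all vectors [v y], hence zero. *)

Lemma prime_power_gt1 (q : nat) : prime_power q -> (1 < q)%N.
Proof.
by case=> p [e [pp e0 ->]]; rewrite -(expn0 p) ltn_exp2l // prime_gt1.
Qed.

Definition frob_col (F : finFieldType) (q s m : nat) (x : F) : 'cV[F]_m :=
  \col_(i < m) x ^+ (q ^ (s * i))%N.

Section FrobeniusPowers.
Variables (F : finFieldType) (q s m : nat).
Hypotheses (q_pp : prime_power q) (m_gt0 : (0 < m)%N) (cardF : #|F| = (q ^ m)%N).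

(** As [#|F|] is a power of the prime dividing [q], that prime is the characteristic; hence raising
    to the power [q ^ k] is additive. *)
Lemma pchar_nat_prime_power (k : nat) : [pchar F].-nat (q ^ k)%N.
Proof.
case: q_pp => p [e [p_pr e_gt0 qE]].
have pF : p \in [pchar F].
  by apply: (@card_finPcharP F p (e * m)) => //; rewrite expnM -qE.
by rewrite (eq_pnat _ (pcharf_eq pF)) qE -expnM pnatX pnat_id.
Qed.

Lemma expr_sum_qpow (k : nat) (I : finType) (E : I -> F) :
  (\sum_i E i) ^+ (q ^ k) = \sum_i E i ^+ (q ^ k).
Proof.
apply: (big_morph (fun x : F => x ^+ (q ^ k))) => [x y|].
  by rewrite exprDn_pchar // pchar_nat_prime_power.
by rewrite expr0n expn_eq0 -leqn0 leqNgt ltnW ?prime_power_gt1.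
Qed.

Lemma expr_qpow_mod (x : F) (k : nat) : x ^+ (q ^ (k %% m)) = x ^+ (q ^ k).
Proof.
rewrite {2}(divn_eq k m); elim: (k %/ m)%N => [|d IH]; first by rewrite add0n.
by rewrite mulSn -addnA expnD -cardF exprM expf_card.
Qed.

Hypotheses (s_gt0 : (0 < s)%N) (s_m : coprime s m).

Lemma qpow_fun_free (c : 'I_m -> F) :
  (forall x, \sum_j c j * x ^+ (q ^ (s * j)) = 0) -> forall j, c j = 0.
Proof.
move=> c0 j; have q_gt1 := prime_power_gt1 q_pp.
(* Reducing the exponents [s * j] modulo [m] keeps the values on [F] but brings the degree below
   [#|F|], so [P] has too many roots to be nonzero. *)
pose P : {poly F} := \sum_(j < m) c j *: 'X^(q ^ ((s * j) %% m)).
have rootP x : root P x.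
  rewrite /root horner_sum -[X in _ == X](c0 x); apply/eqP/eq_bigr => i _.
  by rewrite hornerZ hornerXn expr_qpow_mod.
have sizeP : (size P <= #|F|)%N.
  apply: (leq_trans (size_sum _ _ _)); apply/bigmax_leqP => i _.
  rewrite (leq_trans (size_scale_leq _ _)) // size_polyXn cardF ltn_exp2l //.
  exact: ltn_pmod.
have P0 : P = 0.
  apply/eqP/negPn/negP => nzP.
  have rootsP : all (root P) (enum F) by apply/allP => x _.
  by have := max_poly_roots nzP rootsP (enum_uniq F); rewrite -cardE ltnNge sizeP.
move: (congr1 (fun p : {poly F} => p`_(q ^ ((s * j) %% m))) P0).
rewrite coef0 coef_sum (bigD1 j) //= big1 => [|i ij].
  by rewrite coefZ coefXn eqxx mulr1 addr0.
rewrite coefZ coefXn eqn_exp2l // (_ : (_ == _) = false) ?mulr0 //.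
apply: contraNF ij => /eqP/esym sij; apply/eqP/val_inj => /=.
(* By symmetry [i - j] is not truncated; [m] divides [s * (i - j)], hence [i - j], which is less
   than [m]. *)
wlog le_ji : i j sij / (j <= i)%N.
  by move=> W; case/orP: (leq_total j i) => ?; [exact: W|apply/esym/W].
apply/eqP; move/eqP: sij; rewrite eqn_mod_dvd ?leq_mul2l ?le_ji ?orbT //.
rewrite -mulnBr Gauss_dvdr 1?coprime_sym // /dvdn modn_small.
  by rewrite subn_eq0 eqn_leq le_ji andbT.
exact: leq_ltn_trans (leq_subr _ _) (ltn_ord i).
Qed.

Lemma frob_col_free (n : nat) (A B : 'M[F]_(n, m)) :
  (forall x, A *m frob_col q s m x = B *m frob_col q s m x) -> A = B.
Proof.
move=> AB; apply/matrixP => i j; apply/eqP; rewrite -subr_eq0; apply/eqP.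
apply: (@qpow_fun_free (fun j => A i j - B i j)) => x.
move/matrixP/(_ i 0): (AB x); rewrite !mxE => /eqP.
rewrite -subr_eq0 -sumrB => /eqP ABi; rewrite -[RHS]ABi.
by apply: eq_bigr => k _; rewrite !mxE mulrBl.
Qed.

Lemma frob_col_inj : injective (@frob_col F q s m).
Proof.
move=> x y /matrixP/(_ (Ordinal m_gt0) 0).
by rewrite !mxE muln0 expn0 !expr1.
Qed.

Lemma dickson_frob_col (f : {poly F}) (x : F) : qspolys F q s m f ->
  dickson q s m f *m frob_col q s m x = frob_col q s m f.[x].
Proof.
case=> a fE; apply/colP => i; rewrite !mxE.
have -> : f.[x] = \sum_(j < m) a j * x ^+ (q ^ (s * j)).
  by rewrite fE horner_sum; apply: eq_bigr => j _; rewrite hornerZ hornerXn.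
rewrite expr_sum_qpow.
(* In row [i], column [j] carries the coefficient of index [h j], that is [j - i] modulo [m]. It
   matches the term [h j] of [f.[x]] raised to [q ^ (s * i)], since [h j + i] is [j] modulo [m]. *)
pose h (j : 'I_m) : 'I_m := Ordinal (ltn_pmod (j + m - i) m_gt0).
have hE (j : 'I_m) : h j + i = j %[mod m].
  rewrite /= modnDml subnK ?modnDr // (leq_trans (ltnW (ltn_ord i))) //.
  exact: leq_addl.
have h_inj : injective h.
  move=> j k hjk; apply/val_inj => /=.
  by rewrite -(modn_small (ltn_ord j)) -(modn_small (ltn_ord k)) -!hE hjk.
rewrite [RHS](reindex_inj h_inj); apply: eq_bigr => j _.
have fhj : f`_(q ^ (s * h j)) = a (h j).
  by rewrite fE qspoly_coef ?prime_power_gt1.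
rewrite !mxE fhj exprMn -exprM -expnD -mulnDr.
rewrite -[x ^+ (q ^ (s * (_ + _)))]expr_qpow_mod.
by rewrite -modnMmr hE modnMmr expr_qpow_mod.
Qed.

Lemma dickson_unit (f : {poly F}) :
  qspolys F q s m f -> invertible_poly f -> dickson q s m f \in unitmx.
Proof.
move=> qf [g _ gK]; rewrite -row_free_unit; apply: inj_row_free => c cD0.
apply: frob_col_free => y; rewrite mul0mx.
by rewrite -[y]gK -dickson_frob_col // mulmxA cD0 mul0mx.
Qed.

Lemma stab_dickson (A : 'M[F]_m) :
  (forall x, Gset F q s m (A *m frob_col q s m x)) ->
  exists2 f, qspolys F q s m f & A = dickson q s m f.
Proof.
move=> AG; pose f : {poly F} := \sum_(j < m) A (Ordinal m_gt0) j *: 'X^(q ^ (s * j)).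
have qf : qspolys F q s m f by exists (A (Ordinal m_gt0)).
exists f => //; apply: frob_col_free => x; rewrite dickson_frob_col //.
case: (AG x) => y _ yE; rewrite -yE; congr (frob_col q s m _).
(* Entry 0 of [frob_col q s m y] is [y] itself, so row 0 of [A] forces [y = f.[x]]. *)
move/matrixP/(_ (Ordinal m_gt0) 0): yE; rewrite !mxE muln0 expn0 expr1 => ->.
by rewrite horner_sum; apply: eq_bigr => j _; rewrite mxE hornerZ hornerXn.
Qed.

End FrobeniusPowers.

Theorem theorem4p4 (q m s : nat) (F : finFieldType)
    (hq : prime_power q) (hm : (0 < m)%N) (hF : #|F| = (q ^ m)%N)
    (hs : (1 <= s <= m)%N) (hsm : coprime s m) :
  stabGL (Gset F q s m) =
  [set dickson q s m f | f in
     [set f : {poly F} | qspolys F q s m f /\ invertible_poly f]].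
Proof.
have /andP[s0 _] := hs.
apply/seteqP; split=> [A [Au AG]|_ [f [qf fbij] <-]].
  have [x|f qf AE] := stab_dickson hq hm hF s0 hsm (A := A).
    by rewrite -AG; exists (frob_col q s m x) => //; exists x.
  (* [F] is finite, so injectivity suffices; it follows from that of [A] and of [frob_col]. *)
  exists f => //; split=> //; apply: injF_bij => x y fxy.
  apply: (frob_col_inj (q := q) (s := s) hm).
  apply: (can_inj (mulKmx Au)).
  by rewrite AE !(dickson_frob_col hq hm hF s0) // fxy.
split; first exact: dickson_unit.
have [g _ gK] := fbij.
apply/seteqP; split=> [_ [_ [x _ <-] <-]|_ [y _ <-]].
  by exists f.[x] => //; rewrite -[LHS](dickson_frob_col hq hm hF s0).
exists (frob_col q s m (g y)); first by exists (g y).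
by rewrite (dickson_frob_col hq hm hF s0) // gK.
Qed.
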